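(* Let $X_1,\dots,X_n$ be independent random vectors in a separable Banach space $(\mathfrak X,\|\cdot\|)$, and let $S_n:=X_1+\dots+X_n$. Suppose that $\mathsf E\|S_n\|<\infty$. For each $i=1,\dots,n$, take any $x_i\in\mathfrak X$. Then for any $f\in\mathcal F_{1,2}\setminus\{0\}$, $$\mathsf E f(\|S_n\|)\le f(\mathsf E\|S_n\|)+\kappa_fC_f\sum_{i=1}^n\mathsf E f\big(\|X_i-x_i\|\big).$$ Moreover, for any $p\in(1,2]$, $$\mathsf E\|S_n\|^p\le(\mathsf E\|S_n\|)^p+\tilde\kappa_p\tilde C_p\sum_{i=1}^n\mathsf E\|X_i-x_i\|^p.$$
   Context: $\mathcal F_{1,2}$ is the class of all continuously differentiable functions $f:\mathbb R\to\mathbb R$ such that $f(0)=0$, $f$ is even, and $f'$ is nondecreasing and concave on $[0,\infty)$ (any nonzero such $f$ is $>0$ on $\mathbb R\setminus\{0\}$). For $f\in\mathcal F_{1,2}\setminus\{0\}$, $$C_f:=\sup_{0<x<s<\infty}\frac{f(x-s)-f(x)+sf'(x)}{f(s)},$$ $$\kappa_f:=\sup\Big\{\frac{U_f(c,s,0)}{U_f(c,s,a)}\colon s\in(0,\infty),\ c\in(0,\tfrac s2),\ a\in(0,c)\Big\},\qquad U_f(c,s,a):=c\,f(s-c+a)+(s-c)\,f(a-c).$$ For $p\in(1,2]$, $\tilde C_p:=C_{|\cdot|^p}$ and $\tilde\kappa_p:=\kappa_{|\cdot|^p}$. Expectations of nonnegative random variables may equal $+\infty$. *)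

(* Defs.v *)
From mathcomp Require Import all_boot all_order all_algebra.
From mathcomp Require Import all_classical all_reals all_analysis.

Set Implicit Arguments.
Unset Strict Implicit.
Unset Printing Implicit Defensive.

Import Order.TTheory GRing.Theory Num.Theory.
Import numFieldNormedType.Exports.

Local Open Scope classical_set_scope.
Local Open Scope ring_scope.

Definition separable_space (T : topologicalType) : Prop :=
  exists2 D : set T, countable D & dense D.

Definition borel (R : realType) (V : completeNormedModType R) :
    measurableType ((@open V).-sigma) :=
  g_sigma_algebraType (@open V).

Definition mutually_independent d d' (T : measurableType d)
    (U : measurableType d') (R : realType) (P : probability T R)
    (I : finType) (X : I -> T -> U) : Prop :=
  forall (J : {set I}) (A : I -> set U), (forall i, measurable (A i)) ->
    P (\bigcap_(i in [set` J]) (X i @^-1` A i)) =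
    (\prod_(i in J) P (X i @^-1` A i))%E.

Section F12.
Variable R : realType.
Implicit Type f : R -> R.

Definition concave_function (D : set R) (g : R -> R) : Prop :=
  @convex_function R R^o D (fun x => - g x).

Definition F12 f : Prop :=
  [/\ (forall x, derivable f x 1) /\ continuous (derive1 f),
      f 0 = 0,
      forall x, f (- x) = f x,
      {in `[0, +oo[ &, {homo derive1 f : x y / x <= y}} &
      concave_function `[0, +oo[ (derive1 f)].

(* The suprema are taken in the extended reals, so that neither definition
   presupposes that they are finite. *)
Definition C_ f : \bar R :=
  ereal_sup [set r | exists x s : R, [/\ 0 < x, x < s &
    r = ((f (x - s) - f x + s * derive1 f x) / f s)%:E]].

Definition U_ f (c s a : R) : R := c * f (s - c + a) + (s - c) * f (a - c).

Definition kappa f : \bar R :=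
  ereal_sup [set r | exists s c a : R,
    [/\ 0 < s, 0 < c < s / 2, 0 < a < c &
        r = (U_ f c s 0 / U_ f c s a)%:E]].

Definition absp (p : R) : R -> R := fun x => `|x| `^ p.

Definition Ctilde (p : R) : \bar R := C_ (absp p).

Definition kappatilde (p : R) : \bar R := kappa (absp p).

End F12.

(* Main.v *)
Require Import Defs.
From mathcomp Require Import all_boot all_order all_algebra.
From mathcomp Require Import all_classical all_reals all_analysis.
From HB Require Import structures.
From mathcomp Require Import measurable_realfun.
From mathcomp Require Import ring lra.
Set Implicit Arguments.
Unset Strict Implicit.
Unset Printing Implicit Defensive.
Import Order.TTheory GRing.Theory Num.Theory.
Import numFieldNormedType.Exports.
Local Open Scope classical_set_scope.
Local Open Scope ring_scope.

(** Fix [f] in the class and let [h] be its derivative. Everything rests on one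
    pointwise inequality ([F12_recentering]), with [K = kappa f * C_ f]: for all
    [m] and [b] there is a slope [L] such that, for every real [y],
      [f y <= f m + L * (y - m) + K * f (y - b)].
    Integrated against a random variable [Y] of mean [m], the linear term
    vanishes and [E f(Y) <= f (E Y) + K * E f(Y - b)] remains, whatever [b] is.

    The pointwise inequality combines two facts. The constant [C_ f] bounds the
    second-order remainder, [f (m + u) <= f m + u * h m + C_ f * f u]
    ([F12_C_taylor]): the definition of [C_ f] covers the increments that jump
    over the origin, and for the others subadditivity of [h] bounds the remainder
    by [f u] itself. The constant [kappa f] is the price of translating a centred
    two-point law, [E f(X) <= kappa f * E f(X + a)] ([F12_kappa_two_point]): the
    definition covers some translations, tangent lines and a limit the others.
    Quantified over all centred two-point laws, the latter says exactly that
    [f x - kappa f * f (x + a)] has slope from the origin never larger at a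
    positive [x] than at a negative one, so some line through the origin
    dominates it ([exists_separating_slope]). This Lagrange multiplier replaces
    the decomposition of a centred law into two-point ones.

    The probabilistic part is an induction on the number of summands
    ([expectation_sum_recentering]) in which the norm is generalized to an
    arbitrary nonnegative 1-Lipschitz [g]. Put [S' = S - X_0] and
    [g' u = E g(X_0 + u)], which is again nonnegative and 1-Lipschitz. For
    each fixed [u] the variable [Y = g(X_0 + u)] lies within [|X_0 - x_0|] of the
    constant [b = g(x_0 + u)], so the one-variable bound gives
    [E f(g(X_0 + u)) <= f (g' u) + K * E f(|X_0 - x_0|)]. By independence, taking
    [u = S'] and integrating yields
    [E f(g(S)) <= E f(g'(S')) + K * E f(|X_0 - x_0|)], and [E g'(S') = E g(S)]
    lets the induction go on. The functions [g'] are the conditional expectations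
    of the martingale obtained by revealing the summands one by one; Tonelli on
    the product law is all that is used of them. Separability enters only
    through the Borel measurability of addition.

    The second assertion is the first one for [f = |.|^p], which belongs to the
    class because [x^(p-1)] is nondecreasing and concave when [1 < p <= 2]. *)

(** * Calculus on the real line *)

Section Calculus.
Context {R : realType}.
Implicit Types (f phi dphi : R -> R).

Lemma ler_is_derive_ge0 phi dphi (a b : R) : a <= b ->
  (forall x : R, is_derive x 1 phi (dphi x)) ->
  (forall x, a <= x <= b -> 0 <= dphi x) -> phi a <= phi b.
Proof.
move=> ab dphiE dphi0.
have dE x : x \in `]a, b[ -> is_derive x 1 phi (dphi x) by move=> _; exact: dphiE.
have [|c cab E] := MVT_segment ab dE.
  apply: continuous_subspaceT => x.
  by apply/differentiable_continuous/derivable1_diffP; have [] := dphiE x.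
by rewrite -subr_ge0 E mulr_ge0 ?subr_ge0 // dphi0 // -in_itv.
Qed.

(** Suprema over an open range of translations give inequalities inside an open
    interval; this carries them to its ends. *)
Lemma continuous_ge0_closed_itv phi (a b : R) : a < b -> continuous phi ->
  (forall x, a < x < b -> 0 <= phi x) -> 0 <= phi a /\ 0 <= phi b.
Proof.
move=> ab cphi phi0; split.
- have cvg : phi x @[x --> a^'+] --> phi a by exact/cvg_at_right_filter/cphi.
  rewrite -(cvg_lim _ cvg) //; apply: limr_ge; first by apply/cvg_ex; exists (phi a).
  near=> x; apply: phi0; apply/andP; split; near: x.
    exact: nbhs_right_gt.
  exact: nbhs_right_lt.
- have cvg : phi x @[x --> b^'-] --> phi b by exact/cvg_at_left_filter/cphi.
  rewrite -(cvg_lim _ cvg) //; apply: limr_ge; first by apply/cvg_ex; exists (phi b).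
  near=> x; apply: phi0; apply/andP; split; near: x.
    exact: nbhs_left_gt.
  exact: nbhs_left_lt.
Unshelve. all: by end_near. Qed.

(** The hypothesis compares all the ratios [A x / x] with all the ratios
    [B y / y], so the supremum of the former lies between both families. *)
Lemma exists_separating_slope (A B : R -> R) :
  (forall x y, 0 < x -> 0 < y -> y * A x <= x * B y) ->
  exists l : R, (forall x, 0 < x -> A x <= l * x) /\
                (forall y, 0 < y -> l * y <= B y).
Proof.
move=> AB.
pose E := [set A x / x | x in [set x | 0 < x]].
have EB y : 0 < y -> ubound E (B y / y).
  move=> y0 _ [x /= x0 <-].
  by rewrite ler_pdivrMr // mulrAC ler_pdivlMr // mulrC [leRHS]mulrC AB.
have E0 : E !=set0 by exists (A 1 / 1); exists 1 => //=.
have hE : has_sup E by split=> //; exists (B 1 / 1); exact: EB.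
exists (sup E); split=> [x x0|y y0].
  by rewrite -ler_pdivrMr //; apply: ub_le_sup; [case: hE | exists x].
by rewrite -ler_pdivlMr //; apply: ge_sup => //; exact: EB.
Qed.

End Calculus.

(** * The class F12 and the constants C_f and kappa_f *)

Section ClassF12.
Context {R : realType} (f : R -> R) (Ff : F12 f).
Let h : R -> R := derive1 f.
Implicit Types a b c e s t u x y : R.

Let f_derive (x : R) : is_derive x 1 f (h x).
Proof. by case: Ff => -[df _] _ _ _ _; rewrite /h derive1E; exact/derivableP. Qed.

Lemma F12_continuous : continuous f.
Proof.
by move=> x; apply/differentiable_continuous/derivable1_diffP; have [] := f_derive x.
Qed.

Let f_even x : f (- x) = f x.
Proof. by case: Ff. Qed.

Let f0 : f 0 = 0.
Proof. by case: Ff. Qed.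

Let f_derive_affine (a b t : R) :
  is_derive t 1 (fun u => f (a + b * u)) (b * h (a + b * t)).
Proof.
have dg : is_derive t 1 (fun u : R => a + b * u) b.
  by apply: is_derive_eq; rewrite /GRing.scale /=; ring.
by have := @is_derive1_comp R f (fun u => a + b * u) t _ _ (f_derive _) dg; rewrite mulrC.
Qed.

Let hN x : h (- x) = - h x.
Proof.
have d1 := f_derive_affine 0 (-1) x.
have E : (fun u => f (0 + -1 * u)) = f.
  by apply/funext => u; rewrite add0r mulN1r f_even.
rewrite E in d1.
have /esym := @derive_val _ _ _ _ _ _ _ d1.
rewrite (@derive_val _ _ _ _ _ _ _ (f_derive x)) add0r !mulN1r => /esym ->.
by rewrite opprK.
Qed.

Let h0 : h 0 = 0.
Proof. by have := hN 0; rewrite oppr0; lra. Qed.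

Let h_ndecr_ge0 x y : 0 <= x -> x <= y -> h x <= h y.
Proof.
move=> x0 xy; case: Ff => _ _ _ + _; apply=> //.
  by rewrite in_itv/= andbT.
by rewrite in_itv/= andbT (le_trans x0).
Qed.

Let h_ge0 x : 0 <= x -> 0 <= h x.
Proof. by move=> x0; rewrite -h0 h_ndecr_ge0. Qed.

Let h_ndecr x y : x <= y -> h x <= h y.
Proof.
move=> xy; have [x0|x0] := leP 0 x; first exact: h_ndecr_ge0.
have [y0|y0] := leP 0 y.
  rewrite (@le_trans _ _ 0) ?h_ge0 //.
  by rewrite -(opprK x) hN oppr_le0 h_ge0 // oppr_ge0 ltW.
rewrite -(opprK x) -(opprK y) hN [leRHS]hN lerN2 h_ndecr_ge0 ?lerN2 //.
by rewrite oppr_ge0 ltW.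
Qed.

Let h_concave a b t : 0 <= a -> 0 <= b -> 0 <= t <= 1 ->
  t * h a + (1 - t) * h b <= h (t * a + (1 - t) * b).
Proof.
move=> a0 b0 /andP[t0 t1]; case: Ff => _ _ _ _ /(_ (Itv01 t0 t1)).
move=> /(_ a b); rewrite !inE /= !in_itv /= !andbT => /(_ a0 b0).
by rewrite /conv /= /conv /= -!/(h _) /GRing.scale /= !mulrN -opprD lerN2.
Qed.

(** Concavity between [0], where [h] vanishes, and [y]. *)
Let h_ratio x y : 0 <= x -> x <= y -> x * h y <= y * h x.
Proof.
move=> x0 xy; have [->|yn0] := eqVneq y 0.
  by rewrite h0 mulr0 mul0r.
have y0 : 0 < y by rewrite lt_neqAle eq_sym yn0 (le_trans x0).
have := @h_concave y 0 (x / y) (ltW y0) (lexx _).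
rewrite h0 !mulr0 !addr0 divfK // divr_ge0 ?(ltW y0) //= ler_pdivrMr // mul1r.
by move=> /(_ xy); rewrite mulrAC ler_pdivrMr // mulrC [leRHS]mulrC mulrC.
Qed.

Let h_subadd x y : 0 <= x -> 0 <= y -> h (x + y) <= h x + h y.
Proof.
move=> x0 y0; have [xy0|xy0] := eqVneq (x + y) 0.
  by rewrite xy0 h0 addr_ge0 // h_ge0.
have {}xy0 : 0 < x + y by rewrite lt_neqAle eq_sym xy0 addr_ge0.
have hx := @h_ratio x (x + y) x0; have hy := @h_ratio y (x + y) y0.
rewrite -(ler_pM2l xy0) mulrDr mulrDl; apply: lerD.
  by apply: hx; rewrite lerDl.
by apply: hy; rewrite lerDr.
Qed.

(** Every integral inequality on [f] below is the monotonicity of a function of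
    this shape, whose derivative has a sign by a property of [h]. *)
Let f_derive_comb k1 a b k2 c e k3 k4 t :
  is_derive t 1
    (fun u => k1 * f (a + b * u) + k2 * f (c + e * u) + k3 * u + k4 * u ^+ 2)
    (k1 * (b * h (a + b * t)) + k2 * (e * h (c + e * t)) + k3 + k4 * (2 * t)).
Proof.
have d1 := f_derive_affine a b t; have d2 := f_derive_affine c e t.
by apply: is_derive_eq; rewrite /GRing.scale /=; ring.
Qed.

Lemma F12_tangent x u : f x + u * h x <= f (x + u).
Proof.
(* the statement is invariant under the reflection (x, u) -> (- x, - u) *)
wlog u0 : x u / 0 <= u.
  move=> H; have [|u0] := leP 0 u; first exact: H.
  have := H (- x) (- u); rewrite oppr_ge0 (ltW u0) => /(_ isT).
  by rewrite -opprD !f_even hN mulrNN.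
have := @ler_is_derive_ge0 _ _ _ 0 u u0 (f_derive_comb 1 x 1 0 0 0 (- h x) 0).
rewrite /= !mulr0 !mul0r !addr0 !mul1r => /(_ _)/wrap[|+].
  move=> t /andP[t0 _]; rewrite !mul0r !mul1r !addr0 subr_ge0 h_ndecr //.
  by rewrite lerDl.
by lra.
Qed.

Lemma F12_ge0 x : 0 <= f x.
Proof. by have := F12_tangent 0 x; rewrite f0 h0 mulr0 !add0r. Qed.

Lemma F12_ndecr x y : 0 <= x -> x <= y -> f x <= f y.
Proof.
move=> x0 xy; rewrite -(subrKC x y); apply: le_trans (F12_tangent _ _).
by rewrite lerDl mulr_ge0 ?subr_ge0 ?h_ge0.
Qed.

Lemma F12_le_norm x y : `|x| <= y -> f x <= f y.
Proof.
move=> xy; have -> : f x = f `|x| by have [|] := ger0P x; rewrite ?f_even.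
by rewrite F12_ndecr.
Qed.

(** With [f_taylor_backward]: the remainder is the integral over [0 <= t <= u] of
    [h (x + t) - h x], resp. [h x - h (x - t)], and both are at most [h t] by
    subadditivity. *)
Let f_taylor_same_sign x u : 0 <= x -> 0 <= u -> f (x + u) <= f x + u * h x + f u.
Proof.
move=> x0 u0.
have := @ler_is_derive_ge0 _ _ _ 0 u u0 (f_derive_comb 1 0 1 (-1) x 1 (h x) 0).
rewrite /= !mulr0 !mul0r !addr0 !mul1r !add0r f0 => /(_ _)/wrap[|].
  move=> t /andP[t0 _]; rewrite !mul0r !mul1r !addr0 add0r mulN1r.
  by have := h_subadd x0 t0; lra.
by lra.
Qed.

Let f_taylor_backward x u : 0 <= u -> u <= x -> f (x - u) <= f x - u * h x + f u.
Proof.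
move=> u0 ux.
have := @ler_is_derive_ge0 _ _ _ 0 u u0 (f_derive_comb 1 0 1 (-1) x (-1) (- h x) 0).
rewrite /= !mulr0 !mul0r !addr0 !mul1r !add0r f0 !mulN1r => /(_ _)/wrap[|].
  move=> t /andP[t0 tu]; rewrite !mul0r !mul1r !addr0 add0r !mulN1r opprK.
  have xt : 0 <= x - t by rewrite subr_ge0 (le_trans tu).
  by have := h_subadd t0 xt; rewrite subrKC; lra.
by lra.
Qed.

(** Midpoint concavity of [h], integrated over the pairs of points of [[0, s]]
    symmetric about [s / 2]. *)
Let f_le_midpoint s : 0 <= s -> f s <= s * h (s / 2).
Proof.
move=> s0; have r0 : 0 <= s / 2 by rewrite divr_ge0.
have := @ler_is_derive_ge0 _ _ _ 0 _ r0
  (f_derive_comb (-1) (s / 2) 1 1 (s / 2) (-1) (2 * h (s / 2)) 0).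
rewrite /= !mulr0 !mul0r !addr0 !mul1r !mulN1r subrr f0 -splitr addr0.
rewrite addNr => /(_ _)/wrap[|].
  move=> t /andP[t0 tr]; rewrite mul0r addr0 !mul1r !mulN1r.
  have a0 : 0 <= s / 2 + t by rewrite addr_ge0.
  have b0 : 0 <= s / 2 - t by rewrite subr_ge0.
  have := @h_concave _ _ (1 / 2) a0 b0 _.
  have -> : 1 / 2 * (s / 2 + t) + (1 - 1 / 2) * (s / 2 - t) = s / 2 by lra.
  by move=> /(_ _)/wrap[|]; lra.
by lra.
Qed.

(** By concavity the graph of [h] on [[0, s]] is above its chord, so the area
    under it is at least that of a triangle. *)
Let f_ge_triangle s : 0 <= s -> s * h s <= 2 * f s.
Proof.
move=> s0; have [->|sn0] := eqVneq s 0; first by rewrite mul0r f0 mulr0.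
have {}sn0 : 0 < s by rewrite lt_neqAle eq_sym sn0.
have := @ler_is_derive_ge0 _ _ _ 0 s s0 (f_derive_comb (2 * s) 0 1 0 0 0 0 (- h s)).
rewrite /= !(mulr0, mul0r, addr0, mul1r, add0r, f0) expr0n mulr0 => /(_ _)/wrap[|H].
  move=> t /andP[t0 ts]; rewrite !(mulr0, mul0r, addr0, mul1r, add0r).
  by have := h_ratio t0 ts; nra.
rewrite -(ler_pM2l sn0); nra.
Qed.

Hypothesis fN0 : f <> cst 0.

Lemma F12_gt0 s : 0 < s -> 0 < f s.
Proof.
move=> s0; have hs : 0 < h s; last first.
  by have := f_ge_triangle (ltW s0); have := mulr_gt0 s0 hs; lra.
rewrite lt_neqAle h_ge0 ?(ltW s0) // andbT eq_sym; apply/eqP => hs.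
(* a derivative vanishing at one positive point vanishes before it by
   monotonicity and beyond it by concavity *)
have hz y : 0 <= y -> h y = 0.
  move=> y0; apply/eqP; rewrite eq_le h_ge0 // andbT.
  have [ys|/ltW sy] := leP y s; first by rewrite -hs h_ndecr.
  by have := h_ratio (ltW s0) sy; rewrite hs mulr0 pmulr_rle0.
have fz y : 0 <= y -> f y = 0.
  move=> y0; apply/eqP; rewrite eq_le F12_ge0 andbT.
  by rewrite (le_trans (f_le_midpoint y0)) // hz ?mulr0 // divr_ge0.
apply: fN0; apply/funext => y /=; have [/fz//|y0] := leP 0 y.
by rewrite -f_even fz // oppr_ge0 ltW.
Qed.

(** The definition of [C_ f] only covers [u < - x < 0] up to reflection. Elsewhere
    the remainder is at most [f u], which is why [1 <= C_ f] matters; the pair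
    [x = s / 2] already witnesses it, since there the numerator is
    [s * h (s / 2)], at least [f s] by [f_le_midpoint]. *)
Lemma F12_C_taylor : exists C : R, [/\ C_ f = C%:E, 1 <= C &
  forall x u, f (x + u) <= f x + u * h x + C * f u].
Proof.
have Cub : (C_ f <= 3%:E)%E.
  apply: ge_ereal_sup => _ [x [s [x0 xs ->]]].
  have s0 := lt_trans x0 xs.
  rewrite lee_fin ler_pdivrMr ?F12_gt0 // -[derive1 f]/h.
  have : f (x - s) <= f s.
    rewrite -f_even opprB F12_ndecr // ?subr_ge0 ?(ltW xs) //.
    by rewrite gerBl ltW.
  have : s * h x <= s * h s by rewrite ler_pM2l // h_ndecr // ltW.
  have := f_ge_triangle (ltW s0); have := F12_ge0 x; lra.
have Clb x s : 0 < x -> x < s ->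
    (((f (x - s) - f x + s * h x) / f s)%:E <= C_ f)%E.
  by move=> x0 xs; apply: ereal_sup_ubound; exists x, s.
have C1 : (1%:E <= C_ f)%E.
  (* s = 1 is an arbitrary scale *)
  apply: le_trans (Clb (1 / 2) 1 _ _); [|by lra..].
  rewrite lee_fin ler_pdivlMr ?F12_gt0 //.
  have -> : 1 / 2 - 1 = - (1 / 2) :> R by lra.
  by have := f_le_midpoint (@ler01 R); rewrite f_even; lra.
have Cfin : C_ f \is a fin_num.
  by rewrite fin_numE; apply/andP; split; apply/eqP => E; rewrite E in Cub C1.
exists (fine (C_ f)); rewrite fineK //; split=> //.
  by rewrite -lee_fin fineK.
set C := fine _; have C1' : 1 <= C by rewrite -lee_fin fineK.
have fC u : f u <= C * f u by rewrite ler_peMl ?F12_ge0.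
move=> x u; wlog x0 : x u / 0 <= x.
  move=> H; have [|x0] := leP 0 x; first exact: H.
  have := H (- x) (- u); rewrite oppr_ge0 (ltW x0) => /(_ isT).
  by rewrite -opprD !f_even hN mulrNN.
have [u0|u0] := leP 0 u.
  by have := f_taylor_same_sign x0 u0; have := fC u; lra.
have [s s0 ->] : exists2 s, 0 < s & u = - s by exists (- u); rewrite ?oppr_gt0 ?opprK.
rewrite [f (- s)]f_even; have := fC s.
have [sx|xs] := leP s x; first by have := f_taylor_backward (ltW s0) sx; lra.
have [->|xn0] := eqVneq x 0; first by rewrite add0r f_even f0 h0; lra.
have := Clb x s _ xs; rewrite -(fineK Cfin) lee_fin ler_pdivrMr ?F12_gt0 // -/C.
by move=> /(_ _)/wrap[|]; [rewrite lt_neqAle eq_sym xn0 | lra].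
Qed.

(** The slope [f t / t] is nondecreasing, by convexity and [f 0 = 0]. *)
Let f_ratio a b : 0 <= a -> a <= b -> b * f a <= a * f b.
Proof.
move=> a0 ab; have := F12_tangent a (b - a); have := F12_tangent a (- a).
rewrite subrr f0 subrKC.
move: (f a) (f b) (h a) => p q r H1 H2.
have : 0 <= (b - a) * (a * r - p) by rewrite mulr_ge0; lra.
nra.
Qed.

Let f_quad x u : 0 <= x -> 0 <= u -> f (x + u) <= 2 * f x + 2 * f u.
Proof.
wlog ux : x u / u <= x.
  move=> H x0 u0; have [ux|/ltW xu] := leP u x; first exact: H.
  by rewrite addrC [leRHS]addrC H.
move=> x0 u0; have := f_taylor_same_sign x0 u0.
have := f_taylor_backward u0 ux; have := F12_ge0 (x - u); lra.
Qed.

Let U_gt0 c s a : 0 < c -> c < s / 2 -> a < c -> 0 < U_ f c s a.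
Proof.
move=> c0 cs ac; rewrite /U_ ltr_wpDl //.
  by rewrite mulr_ge0 ?F12_ge0 // ltW.
by rewrite mulr_gt0; [|lra|rewrite -f_even opprB F12_gt0; lra].
Qed.

(** The two sides are, up to the factor [b + c], the expectations of [f (X)] and
    [f (X + a)] for the centred law on [{b, - c}]. By reflection one may take
    [c <= b]. For [a <= 0] or [b = c] the tangent lines of [f] give the inequality
    with constant 1; [0 < a < c] is the definition; past [a = c] the right-hand
    side only grows, so its limit value at [a = c] suffices. *)
Lemma F12_kappa_two_point : exists k : R, [/\ kappa f = k%:E, 1 <= k &
  forall a b c, 0 < b -> 0 < c ->
    c * f b + b * f c <= k * (c * f (b + a) + b * f (a - c))].
Proof.
have kub : (kappa f <= 3%:E)%E.
  apply: ge_ereal_sup => _ [s [c [a [s0 /andP[c0 cs] /andP[a0 ac] ->]]]].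
  rewrite lee_fin ler_pdivrMr ?U_gt0 // /U_ addr0 sub0r f_even.
  rewrite -[f (a - c)]f_even opprB.
  have ca0 : 0 <= c - a by lra.
  have sc0 : 0 <= s - c by lra.
  have asc : a <= s - c by lra.
  have sca : s - c <= s - c + a by lra.
  have := f_quad (ltW a0) ca0; rewrite subrKC => /(ler_wpM2l sc0) H1.
  have := f_ratio (ltW a0) asc => H2.
  have := F12_ndecr sc0 sca => H3.
  have := F12_ge0 (s - c); have := F12_ge0 (c - a).
  move: (f c) (f a) (f (c - a)) (f (s - c)) (f (s - c + a)) H1 H2 H3.
  move=> p q r u v H1 H2 H3 r0 u0.
  have H4 : a * u <= c * u by apply: ler_wpM2r => //; lra.
  have H5 : c * u <= c * v by rewrite ler_pM2l.
  have H6 : 0 <= (s - c) * r by rewrite mulr_ge0.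
  lra.
have klb s c a : 0 < c -> c < s / 2 -> 0 < a -> a < c ->
    ((U_ f c s 0 / U_ f c s a)%:E <= kappa f)%E.
  move=> c0 cs a0 ac; apply: ereal_sup_ubound; exists s, c, a.
  by rewrite c0 cs a0 ac; split=> //; lra.
have kfin : kappa f \is a fin_num.
  rewrite fin_numE; apply/andP; split; apply/eqP => E; last by rewrite E in kub.
  by have := klb 3 1 (1 / 2); rewrite E => /(_ _ _ _ _)/wrap[|||| //]; lra.
exists (fine (kappa f)); rewrite fineK //; set k := fine _.
(* both ends are needed: a = c for large translations, and a = 0 to see that
   1 <= k, which for f = |.|^2 is only reached in the limit *)
have cU c s : continuous (U_ f c s).
  move=> a; apply: cvgD; apply: cvgM; [exact: cvg_cst| |exact: cvg_cst|].
    apply: continuous_comp; last exact: F12_continuous.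
    by apply: cvgD; [exact: cvg_cst|exact: cvg_id].
  apply: continuous_comp; last exact: F12_continuous.
  by apply: cvgB; [exact: cvg_id|exact: cvg_cst].
have kU s c a : 0 < c -> c < s / 2 -> 0 <= a <= c ->
    U_ f c s 0 <= k * U_ f c s a.
  move=> c0 cs.
  have inner x : 0 < x < c -> 0 <= k * U_ f c s x - U_ f c s 0.
    move=> /andP[x0 xc]; rewrite subr_ge0 -ler_pdivrMr ?U_gt0 //.
    by rewrite -lee_fin /k fineK // klb.
  have [|H0 H1] := continuous_ge0_closed_itv c0 _ inner.
    move=> y; apply: cvgB; last exact: cvg_cst.
    by apply: cvgM; [exact: cvg_cst|exact: cU].
  move=> /andP[]; rewrite le_eqVlt => /predU1P[<- _|a0].
    by rewrite -subr_ge0.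
  rewrite le_eqVlt => /predU1P[->|ac]; first by rewrite -subr_ge0.
  by rewrite -subr_ge0 inner // a0.
have k1 : 1 <= k.
  have c3 : 1 < 3 / 2 :> R by lra.
  rewrite -(ler_pM2r (U_gt0 ltr01 c3 ltr01)) mul1r.
  by apply: kU => //; rewrite lexx ler01.
split=> //.
have fk x y : x <= y -> 0 <= x -> x <= k * y.
  by move=> xy x0; rewrite (le_trans xy) // ler_peMl // (le_trans x0).
move=> a b c b0 c0; wlog cb : a b c b0 c0 / c <= b.
  move=> H; have [|/ltW bc] := leP c b; first exact: H.
  have := H (- a) c b c0 b0 bc.
  rewrite -[f (c - a)]f_even -[f (- a - b)]f_even !opprD !opprK.
  by rewrite [- c + a]addrC [a + b]addrC; lra.
have nonneg : 0 <= c * f b + b * f c.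
  by rewrite addr_ge0 // mulr_ge0 ?F12_ge0 // ltW.
(* the coefficient of a is the derivative at a = 0 of the translated
   expectation, nonpositive because h t / t is nonincreasing *)
have tang : a * (c * h b - b * h c) + (c * f b + b * f c) <=
            c * f (b + a) + b * f (a - c).
  have := F12_tangent b a; have := F12_tangent (- c) a.
  rewrite f_even hN [- c + a]addrC.
  by move=> /(ler_wpM2l (ltW b0)) H1 /(ler_wpM2l (ltW c0)); lra.
have slope : c * h b - b * h c <= 0 by rewrite subr_le0 h_ratio // ltW.
have [a0|a0] := leP a 0.
  by apply: fk => //; have := mulr_le0 a0 slope; lra.
move: cb; rewrite le_eqVlt => /predU1P[cb|cb].
  by apply: fk => //; move: tang; rewrite cb subrr mulr0 add0r.
have cs : c < (b + c) / 2 by lra.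
have [ac|/ltW ca] := leP a c.
  have := @kU (b + c) c a c0 cs; rewrite (ltW a0) ac /U_ addrK addr0 sub0r f_even.
  exact.
have := @kU (b + c) c c c0 cs; rewrite (ltW c0) lexx /U_ addrK addr0 sub0r f_even.
move=> /(_ isT)/le_trans; apply; rewrite ler_pM2l ?(lt_le_trans ltr01) //.
rewrite subrr f0 mulr0 addr0; apply: ler_wpDr; first by rewrite mulr_ge0 ?F12_ge0 ?ltW.
by rewrite ler_pM2l // F12_ndecr // ?lerD2l // addr_ge0 // ltW.
Qed.

(** The slope [L] collects the derivative at [m] and the multiplier [l] of the
    centring constraint, for the translation [a = m - b] that turns the centred
    increment [y - m] into [y - b]. *)
Lemma F12_recentering : exists K : R, [/\ (kappa f * C_ f)%E = K%:E, 0 < K &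
  forall m b, exists L, forall y, f y <= f m + L * (y - m) + K * f (y - b)].
Proof.
have [C [CE C1 fC]] := F12_C_taylor; have [k [kE k1 fk]] := F12_kappa_two_point.
have C0 : 0 <= C by lra.
have k0 : 0 <= k by lra.
exists (k * C); split=> [||m b].
- by rewrite CE kE.
- by rewrite mulr_gt0 // (lt_le_trans ltr01).
pose a := m - b.
have [|l [lpos lneg]] := @exists_separating_slope R
    (fun x => f x - k * f (x + a)) (fun x => k * f (a - x) - f x).
  by move=> x y x0 y0; have := fk a x y x0 y0; lra.
have fl x : f x <= k * f (x + a) + l * x.
  have [->|xn0] := eqVneq x 0.
    by rewrite f0 mulr0 addr0 mulr_ge0 // F12_ge0.
  have [x0|x0] := leP x 0.
    have {}x0 : 0 < - x by rewrite oppr_gt0 lt_neqAle xn0.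
    by have := lneg _ x0; rewrite f_even opprK [a + x]addrC; lra.
  by have := lpos _ x0; lra.
exists (h m + C * l) => y.
have := fC m (y - m); rewrite subrKC => /le_trans; apply.
have := fl (y - m); rewrite /a subrKA => /(ler_wpM2l C0).
lra.
Qed.

End ClassF12.

(** * Powers with exponent between 1 and 2 *)

Section Powers.
Context {R : realType}.
Implicit Types p q a b t x : R.

(** Jensen for the convex power [1 / q], applied to [a `^ q] and [b `^ q]. *)
Lemma powR_concave q a b t : 0 < q <= 1 -> 0 <= a -> 0 <= b -> 0 <= t <= 1 ->
  t * a `^ q + (1 - t) * b `^ q <= (t * a + (1 - t) * b) `^ q.
Proof.
move=> /andP[q0 q1] a0 b0 /andP[t0 t1].
have r1 : 1 <= q^-1 by rewrite invf_ge1.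
have := @convex_powR R _ r1 (Itv01 t0 t1) (a `^ q) (b `^ q).
rewrite !inE /= !in_itv /= !andbT => /(_ (powR_ge0 _ _) (powR_ge0 _ _)).
rewrite /conv /= /conv /= /GRing.scale /= -!powRrM !mulfV ?gt_eqF // !powRr1 //.
rewrite -[unstable.onem t]/(1 - t) => H.
have ab0 : 0 <= t * a `^ q + (1 - t) * b `^ q.
  by rewrite addr_ge0 // mulr_ge0 ?powR_ge0 // subr_ge0.
have := ge0_ler_powR (ltW q0) _ _ H; rewrite !nnegrE powR_ge0.
rewrite -powRrM mulVf ?gt_eqF // powRr1 //; apply=> //.
by rewrite addr_ge0 // mulr_ge0 // subr_ge0.
Qed.

(** The odd extension of the power, that is the derivative of
    [|x| `^ (q + 1) / (q + 1)]. *)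
Definition signed_powR q x := Num.sg x * `|x| `^ q.

Let signed_powR_gt0 q x : 0 < x -> signed_powR q x = x `^ q.
Proof. by move=> x0; rewrite /signed_powR gtr0_sg // mul1r gtr0_norm. Qed.

Let signed_powRN q x : signed_powR q (- x) = - signed_powR q x.
Proof. by rewrite /signed_powR sgrN normrN mulNr. Qed.

Let signed_powR0 q : signed_powR q 0 = 0.
Proof. by rewrite /signed_powR sgr0 mul0r. Qed.

Lemma continuous_signed_powR q : 0 < q -> continuous (signed_powR q).
Proof.
move=> q0.
have pos x : 0 < x -> {for x, continuous (signed_powR q)}.
  move=> x0; apply/differentiable_continuous/derivable1_diffP.
  have [] // := @near_eq_is_derive R R R (@powR R ^~ q) (signed_powR q) x 1 _ _
    (is_derive1_powR q x0).
  by near=> y; rewrite signed_powR_gt0 //; near: y; exact: lt_nbhsr.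
move=> x; have [x0|x0|->] := ltgtP x 0.
- have E : signed_powR q = (fun y => - signed_powR q (- y)).
    by apply/funext => y; rewrite signed_powRN opprK.
  rewrite [X in continuous_at _ X]E; apply: cvgN.
  apply: (@continuous_comp _ _ _ -%R (signed_powR q)); first exact: opp_continuous.
  by apply: pos; rewrite oppr_gt0.
- exact: pos.
- rewrite /continuous_at signed_powR0; apply/cvgr0Pnorm_lt => e e0.
  near=> z; rewrite /signed_powR normrM.
  have : `|z| < e `^ q^-1.
    by near: z; apply: (@nbhs0_lt _ R); rewrite powR_gt0.
  move=> zlt; have zq : `|z| `^ q < e.
    rewrite -[ltRHS]powRr1 ?(ltW e0) // -(mulVf (lt0r_neq0 q0)) powRrM.
    by rewrite gt0_ltr_powR // ?nnegrE ?powR_ge0.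
  rewrite [X in _ * X]ger0_norm ?powR_ge0 //; apply: le_lt_trans zq.
  by rewrite ler_piMl ?powR_ge0 // normr_sg lern1; case: (_ != _).
Unshelve. all: by end_near. Qed.

Lemma is_derive_absp p x : 1 < p -> is_derive x 1 (absp p) (p * signed_powR (p - 1) x).
Proof.
move=> p1; have p0 : 0 < p by lra.
have pos (y : R) : 0 < y -> is_derive y 1 (absp p) (p * signed_powR (p - 1) y).
  move=> y0; rewrite signed_powR_gt0 //.
  apply: near_eq_is_derive (is_derive1_powR p y0).
  by near=> z; rewrite /absp gtr0_norm //; near: z; exact: lt_nbhsr.
have [x0|x0|->] := ltgtP x 0; [|exact: pos|].
  have x0' : 0 < - x by rewrite oppr_gt0.
  have := @is_derive1_comp R (absp p) -%R x _ _ (pos _ x0') (is_deriveNid x 1).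
  have -> : absp p \o -%R = absp p by apply/funext => y; rewrite /absp /= normrN.
  by rewrite signed_powRN mulrN mulr1 mulrN opprK.
apply/is_derive1_caratheodory; exists (signed_powR (p - 1)); split.
- move=> z; rewrite /absp normr0 powR0 ?gt_eqF // !subr0 /signed_powR.
  rewrite mulrAC -normrEsg; have [->|z0] := eqVneq z 0.
    by rewrite normr0 powR0 ?gt_eqF // mul0r.
  by rewrite mulrC -{3}(powRr1 (normr_ge0 z)) -powRD ?subrK // normr_eq0 z0 implybT.
- by apply: continuous_signed_powR; lra.
- by rewrite signed_powR0 mulr0.
Unshelve. all: by end_near. Qed.

Lemma F12_absp p : 1 < p <= 2 -> F12 (absp p).
Proof.
move=> /andP[p1 p2]; have p0 : 0 < p by lra.
have q01 : 0 < p - 1 <= 1 by apply/andP; split; lra.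
have /andP[q0 q1] := q01.
have dE : derive1 (absp p) = (fun x => p * signed_powR (p - 1) x).
  by apply/funext => x; rewrite derive1E; have [_ ->] := is_derive_absp x p1.
have dE0 x : 0 <= x -> derive1 (absp p) x = p * x `^ (p - 1).
  rewrite dE le_eqVlt => /predU1P[<-|x0]; last by rewrite signed_powR_gt0.
  by rewrite signed_powR0 powR0 ?gt_eqF.
split.
- split=> [x|]; first by have [] := is_derive_absp x p1.
  rewrite dE => x; apply: cvgM; [exact: cvg_cst|exact: continuous_signed_powR].
- by rewrite /absp normr0 powR0 ?gt_eqF.
- by move=> x; rewrite /absp normrN.
- move=> x y; rewrite !in_itv /= !andbT => x0 y0 xy; rewrite !dE0 //.
  by rewrite ler_pM2l // ge0_ler_powR // ltW.
- move=> t a b; rewrite !inE /= !in_itv /= !andbT => a0 b0.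
  have t0 : 0 <= t%:num by [].
  have t1 : t%:num <= 1 by [].
  have ab0 : 0 <= t%:num * a + (1 - t%:num) * b.
    by rewrite addr_ge0 // mulr_ge0 // subr_ge0.
  rewrite /conv /= /conv /= /GRing.scale /= -[unstable.onem t%:num]/(1 - t%:num).
  rewrite !dE0 // !mulrN -opprD lerN2.
  rewrite mulrCA [X in _ + X]mulrCA -mulrDr ler_pM2l //.
  by apply: powR_concave => //; rewrite t0.
Qed.

Lemma absp_neq0 p : absp p <> cst 0.
Proof.
move=> /(congr1 (fun g => g 1)) /=; rewrite /absp normr1 powR1 => /eqP.
by rewrite oner_eq0.
Qed.

End Powers.

Local Open Scope ereal_scope.

(** * Borel measurability in a separable normed space *)

Section BorelNormed.
Context {R : realType} {V : completeNormedModType R}.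

Lemma measurable_continuous_borel (g : V -> R) :
  continuous g -> measurable_fun setT (g : borel V -> R).
Proof.
move=> /continuousP cg; apply: (measurability _ (RGenOInfty.measurableE R)).
move=> _ [_ [a ->] <-]; rewrite setTI.
by apply: sub_sigma_algebra; apply: cg; exact: interval_open.
Qed.

Lemma separable_dense_sequence : separable_space V ->
  exists e : nat -> V, forall (x : V) (r : R), (0 < r)%R -> exists n, ball (e n) r x.
Proof.
move=> [D /countable_injP[j injj] dD].
exists (fun n => xget 0%R [set x | D x /\ j x = n]) => x r r0.
have [y [yr Dy]] := dD _ (ex_intro _ x (ballxx x r0)) (ball_open x r).
exists (j y); have [] := @xgetPex V 0%R [set x | D x /\ j x = j y] _.
  by exists y.
by move=> Dz /injj ->; [exact: ball_sym | rewrite inE..].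
Qed.

Lemma continuous_lipschitz1 (g : V -> R) :
  (forall u v, `|g u - g v| <= `|u - v|)%R -> continuous g.
Proof.
move=> glip u; apply/cvgrPdist_lt => e e0; near=> v.
by apply: le_lt_trans (glip _ _) _; near: v; exact: cvgr_dist_lt.
Unshelve. all: by end_near. Qed.

Hypothesis sepV : separable_space V.

(** The preimage of an open set under addition is a union of products of open
    balls, which separability makes countable: centres in a dense sequence and
    radii [1 / (n + 1)] are enough. *)
Lemma measurable_borelD d (T : measurableType d) (u v : T -> borel V) :
  measurable_fun setT u -> measurable_fun setT v ->
  measurable_fun setT (fun t => (u t : V) + (v t : V) : borel V)%R.
Proof.
move=> mu mv; have [e edense] := separable_dense_sequence sepV.
apply: (@measurability _ _ T (borel V) setT _ (@open V)) => //.
move=> _ [W /= oW <-]; rewrite setTI.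
pose r n : R := n.+1%:R^-1%R.
have r0 n : (0 < r n)%R by rewrite /r invr_gt0.
pose F (i : nat * nat * nat) : set T :=
  let: (k, l, n) := i in
  if `[< ball (e k + e l)%R (r n + r n)%R `<=` W >]
  then u @^-1` ball (e k) (r n) `&` v @^-1` ball (e l) (r n) else set0.
have mball w (mw : measurable_fun setT w) (x : V) n :
    d.-measurable ((w : T -> borel V) @^-1` ball x (r n)).
  rewrite -[X in measurable X]setTI; apply: mw => //.
  by apply: sub_sigma_algebra; exact: ball_open.
rewrite (_ : _ @^-1` W = \bigcup_i F i).
  apply: countable_bigcupT_measurable; first exact: countableP.
  by case=> -[k l] n; rewrite /F; case: ifPn => // _; apply: measurableI; exact: mball.
apply/seteqP; split=> [t /= Wt|t [[[k l] n] _]]; last first.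
  rewrite /F; case: ifPn => // /asboolP sW [/= uk vl]; apply: sW.
  move: uk vl; rewrite -!ball_normE /= => uk vl.
  by rewrite opprD addrACA (le_lt_trans (ler_normD _ _)) // ltrD.
have [s /= s0 sW] : exists2 s : R, (0 < s)%R & ball (u t + v t : V)%R s `<=` W.
  exact/nbhs_ballP/(open_nbhs_nbhs (conj oW Wt)).
(* z is within 2r of e k + e l, itself within 2r of u t + v t *)
have [n nr] : exists n, (r n < s / 4)%R.
  have s4 : (0 < s / 4)%R by rewrite divr_gt0.
  by have [n _ /(_ n (leqnn n))] := near_infty_natSinv_lt (PosNum s4); exists n.
have [k ku] := edense (u t) _ (r0 n); have [l lv] := edense (v t) _ (r0 n).
exists (k, l, n) => //; rewrite /F ifT //; apply/asboolP => z /= zb; apply: sW.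
rewrite -!ball_normE /= in ku lv zb *.
have -> : (u t + v t - z)%R = ((u t - e k) + (v t - e l) + (e k + e l - z) : V)%R.
  by rewrite [(u t - e k + _)%R]addrACA -opprD subrKA.
rewrite (le_lt_trans (ler_normD _ _)) // (le_lt_trans (lerD (ler_normD _ _) (lexx _))) //.
rewrite distrC in ku; rewrite distrC in lv.
move: ku lv zb nr.
set a := `|_|%R; set b := `|_|%R; set c := `|_|%R; move: (r n) => q; lra.
Qed.

Lemma measurable_borel_sum d (T : measurableType d) n (u : 'I_n -> T -> borel V) :
  (forall i, measurable_fun setT (u i)) ->
  measurable_fun setT (fun t => \sum_(i < n) (u i t : V) : borel V)%R.
Proof.
elim: n u => [|n IH] u mu.
  by under eq_fun do rewrite big_ord0; exact: measurable_cst.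
under eq_fun do rewrite big_ord_recl.
by apply: measurable_borelD => //; apply: IH.
Qed.

End BorelNormed.

(** * Independence and product laws *)

Section Independence.
Context {R : realType} d (T : measurableType d) (P : probability T R).

Lemma ge0_integral_independent d1 d2 (U1 : measurableType d1)
    (U2 : measurableType d2) (u : {RV P >-> U1}) (v : {RV P >-> U2})
    (h : (U1 * U2)%type -> \bar R) :
  (forall A B, measurable A -> measurable B ->
    P (u @^-1` A `&` v @^-1` B) = P (u @^-1` A) * P (v @^-1` B)) ->
  measurable_fun [set: (U1 * U2)%type] h -> (forall z, 0 <= h z) ->
  \int[P]_w h (u w, v w) = \int[P]_w \int[P]_w' h (u w, v w').
Proof.
move=> ind mh h0.
have muv : measurable_fun setT (fun w => (u w, v w)) by exact: measurable_fun_pair.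
pose uv : {RV P >-> (U1 * U2)%type} := HB.pack (fun w => (u w, v w))
  (isMeasurableFun.Build _ _ _ _ _ muv).
rewrite -(ge0_integral_distribution uv mh h0).
rewrite (@eq_measure_integral _ _ _ _ (distribution P u \x distribution P v)); last first.
  by move=> A mA _; apply/esym; apply: product_measure_unique => // B C mB mC; exact: ind.
rewrite fubini_tonelli1 //.
rewrite ge0_integral_distribution //; last 2 first.
- exact: measurable_fun_fubini_tonelli_F.
- by move=> y; apply: integral_ge0.
apply: eq_integral => w _ /=; rewrite /fubini_F.
rewrite ge0_integral_distribution //.
by apply: measurableT_comp => //; exact: measurable_fun_pair.
Qed.

End Independence.

Section IndependentSums.
Context {R : realType} {V : completeNormedModType R} (sepV : separable_space V).
Context d (T : measurableType d) (P : probability T R).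

Lemma mutually_independent_lift n (X : 'I_n.+1 -> T -> borel V) :
  mutually_independent P X -> mutually_independent P (fun i => X (lift ord0 i)).
Proof.
move=> indX J A mA.
pose A' i : set (borel V) := if unlift ord0 i is Some j then A j else setT.
have A'E j : A' (lift ord0 j) = A j by rewrite /A' liftK.
have := indX [set lift ord0 i | i in J]%SET A' _.
rewrite big_imset /=; last by move=> i j _ _; exact: lift_inj.
under eq_bigr do rewrite A'E.
move=> <-; last by move=> i; rewrite /A'; case: (unlift _ _).
congr (P _); apply/seteqP; split=> w /= H i /=.
  by case/imsetP => j jJ ->; rewrite A'E; exact: H.
by move=> iJ; have := H (lift ord0 i); rewrite A'E; apply; apply: imset_f.
Qed.

(** Both the joint probability and, for [B = setT], that of the cylinder alone
    are instances of the product rule. *)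
Let head_tail_cylinder n (X : 'I_n.+1 -> {RV P >-> borel V})
    (A : 'I_n -> set (borel V)) (B : set (borel V)) :
  mutually_independent P (fun i => X i : T -> borel V) ->
  (forall i, measurable (A i)) -> measurable B ->
  P (\bigcap_(i in [set: 'I_n]) (X (lift ord0 i) @^-1` A i) `&` X ord0 @^-1` B) =
  P (X ord0 @^-1` B) * \prod_(i < n) P (X (lift ord0 i) @^-1` A i).
Proof.
move=> indX mA mB.
pose A' i := if unlift ord0 i is Some j then A j else B.
have A'E j : A' (lift ord0 j) = A j by rewrite /A' liftK.
have A'0 : A' ord0 = B by rewrite /A' unlift_none.
have mA' i : measurable (A' i) by rewrite /A'; case: (unlift _ _).
have := indX [set: 'I_n.+1]%SET A' mA'.
rewrite (eq_bigl xpredT) ?big_ord_recl; last by move=> i; rewrite inE.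
rewrite A'0; under eq_bigr do rewrite A'E.
move=> <-; congr (P _); apply/seteqP; split=> w /=.
  move=> [H Bw] i _; case: (unliftP ord0 i) => [j ->|->]; first by rewrite A'E; exact: H.
  by rewrite A'0.
move=> H; split=> [i _|]; last by have := H ord0; rewrite A'0; apply; rewrite /= inE.
by have := H (lift ord0 i); rewrite A'E; apply; rewrite /= inE.
Qed.

(** For fixed [B], the finite measures [E |-> P (E `&` F)] and
    [E |-> P E * P F], with [F] the event [X ord0 \in B], agree on the pi-system
    [G] of cylinders over the remaining variables, hence on the sigma-algebra
    it generates. The partial sum [S'] is measurable for that sigma-algebra. *)
Lemma independent_head_tail n (X : 'I_n.+1 -> {RV P >-> borel V}) (A B : set (borel V)) :
  mutually_independent P (fun i => X i : T -> borel V) ->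
  measurable A -> measurable B ->
  let S' w : borel V := (\sum_(i < n) (X (lift ord0 i) w : V))%R in
  P (S' @^-1` A `&` X ord0 @^-1` B) = P (S' @^-1` A) * P (X ord0 @^-1` B).
Proof.
move=> indX mA mB S'.
pose F := X ord0 @^-1` B.
have mXi i (C : set (borel V)) : measurable C -> measurable (X i @^-1` C).
  by move=> mC; rewrite -[X in measurable X]setTI; exact: (measurable_funP (X i)).
have mF : measurable F by exact: mXi.
pose G : set (set T) := [set E | exists2 C : 'I_n -> set (borel V),
  (forall i, measurable (C i)) &
  E = \bigcap_(i in [set: 'I_n]) (X (lift ord0 i) @^-1` C i)].
have GT : G setT.
  by exists (fun=> setT) => //; rewrite bigcapT.
have Gm : G `<=` d.-measurable.
  move=> _ [C mC ->]; apply: fin_bigcap_measurable; first exact: finite_finset.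
  by move=> i _; exact: mXi.
have GI : setI_closed G.
  move=> _ _ [C mC ->] [D mD ->]; exists (fun i => C i `&` D i).
    by move=> i; exact: measurableI.
  by rewrite -bigcapI; apply: eq_bigcapr => i _; rewrite preimage_setI.
have mS' : <<s G >> (S' @^-1` A).
  have : measurable_fun [set: g_sigma_algebraType G] S'.
    apply: (measurable_borel_sum sepV) => i _ C mC; rewrite setTI.
    apply: sub_sigma_algebra; exists (fun j => if j == i then C else setT).
      by move=> j; case: ifP.
    apply/seteqP; split=> w /= H; last by have := H i Logic.I; rewrite /= eqxx.
    by move=> j _ /=; case: eqP => [->|].
  by move=> /(_ measurableT A mA); rewrite setTI.
have PF0 : (0 <= fine (P F))%R by rewrite fine_ge0.
have PFE : (NngNum PF0)%:num%:E = P F by rewrite /= fineK // fin_num_measure.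
have := @g_sigma_algebra_measure_unique _ R T G Gm (fun=> setT) (fun=> GT) _
  (mrestr P mF) (mscale (NngNum PF0) P) GI _ _ _ mS'.
move=> eqP; rewrite [RHS]muleC -PFE; apply: eqP => /=.
- by rewrite bigcup_const.
- move=> _ [C mC ->]; rewrite [LHS]head_tail_cylinder // /mscale PFE; congr (_ * _).
  have := @head_tail_cylinder n X C setT indX mC measurableT.
  by rewrite preimage_setT setIT probability_setT mul1e => /esym.
- by move=> _; rewrite ltey_eq fin_num_measure // measurableI.
Qed.

End IndependentSums.

(** * Recentring of expectations *)

Section Recentering.
Context {R : realType} d (T : measurableType d) (P : probability T R).

(** The pointwise inequality is integrated at [m = E Y]. It is applied with
    [Z] in place of [Y - b] because only [Z] has an expectation that does not
    depend on the other variables. *)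
Lemma expectation_recentering (f : R -> R) (K : R) (Y Z : T -> R) (b : R) :
  measurable_fun setT f -> (forall y, (0 <= f y)%R) -> (0 < K)%R ->
  (forall m, exists L, forall y, f y <= f m + L * (y - m) + K * f (y - b))%R ->
  (forall y z, `|y| <= z -> f y <= f z)%R ->
  P.-integrable setT (EFin \o Y) -> measurable_fun setT Z ->
  (forall w, `|Y w - b| <= Z w)%R ->
  \int[P]_w (f (Y w))%:E <=
    (f (fine (\int[P]_w (Y w)%:E)))%:E + K%:E * \int[P]_w (f (Z w))%:E.
Proof.
move=> mf f0 K0 frec fmono iY mZ YZ.
have mY : measurable_fun setT Y by apply/measurable_EFinP; have /integrableP[] := iY.
have mfY : measurable_fun setT (fun w => (f (Y w))%:E).
  by apply/measurable_EFinP; exact: measurableT_comp.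
have mfZ : measurable_fun setT (fun w => (f (Z w))%:E).
  by apply/measurable_EFinP; exact: measurableT_comp.
set m := fine _.
have [fZoo|fZfin] := eqVneq (\int[P]_w (f (Z w))%:E) +oo.
  by rewrite fZoo gt0_muley ?lte_fin // addey // leey.
have ifZ : P.-integrable setT (fun w => (f (Z w))%:E).
  apply/integrableP; split=> //.
  under eq_integral do rewrite gee0_abs ?lee_fin //.
  by rewrite ltey.
have [L fL] := frec m.
have iLY : P.-integrable setT (fun w => (f m - L * m)%:E + L%:E * (Y w)%:E).
  apply: integrableD => //; first exact: finite_measure_integrable_cst.
  exact: integrableZl.
have iKZ : P.-integrable setT (fun w => K%:E * (f (Z w))%:E) by exact: integrableZl.
have bound w : (f (Y w) <= (f m - L * m) + L * Y w + K * f (Z w))%R.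
  have := fL (Y w); have := fmono _ _ (YZ w).
  by rewrite -(ler_pM2l K0); lra.
apply: (@le_trans _ _ (\int[P]_w
   ((f m - L * m)%:E + L%:E * (Y w)%:E + K%:E * (f (Z w))%:E))).
  apply: ge0_le_integral => //.
  - by move=> w _; rewrite lee_fin.
  - by have /integrableP[] := integrableD measurableT iLY iKZ.
  - by move=> w _; rewrite -!EFinM -!EFinD lee_fin.
rewrite integralD //= integralD //; last 2 first.
- exact: finite_measure_integrable_cst.
- exact: integrableZl.
rewrite !integralZl // integral_cst //= probability_setT mule1.
have -> : \int[P]_w (Y w)%:E = m%:E by rewrite fineK // integrable_fin_num.
by rewrite -EFinM -EFinD subrK.
Qed.

Context {V : completeNormedModType R} (sepV : separable_space V).

(** The induction removes [X ord0] and replaces [g] by its average [g'] over that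
    variable, so the Lipschitz function has to be arbitrary: starting from the
    norm, the later ones are no longer norms. *)
Lemma expectation_sum_recentering (f : R -> R) (K : R) :
  continuous f -> (forall y, (0 <= f y)%R) -> (0 < K)%R ->
  (forall m b, exists L, forall y, f y <= f m + L * (y - m) + K * f (y - b))%R ->
  (forall y z, `|y| <= z -> f y <= f z)%R ->
  forall n (X : 'I_n -> {RV P >-> borel V}) (x : 'I_n -> V) (g : V -> R),
  mutually_independent P (fun i => X i : T -> borel V) ->
  (forall u, (0 <= g u)%R) -> (forall u v, `|g u - g v| <= `|u - v|)%R ->
  let S w := (\sum_(i < n) (X i w : V))%R in
  \int[P]_w (g (S w))%:E < +oo ->
  \int[P]_w (f (g (S w)))%:E <= (f (fine (\int[P]_w (g (S w))%:E)))%:E +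
    K%:E * \sum_(i < n) \int[P]_w (f `|(X i w : V) - x i|%R)%:E.
Proof.
move=> cf f0 K0 frec fmono; have mf := continuous_measurable_fun cf.
elim=> [|n IH] X x g indX g0 glip S.
  have SE w : S w = 0%R by rewrite /S big_ord0.
  move=> _; rewrite big_ord0 mule0 adde0.
  under eq_integral do rewrite SE.
  under [in leRHS]eq_integral do rewrite SE.
  by rewrite !integral_cst //= probability_setT !mule1.
pose S' w : borel V := (\sum_(i < n) (X (lift ord0 i) w : V))%R.
have mS' : measurable_fun setT S' by exact: (measurable_borel_sum sepV).
pose S'RV : {RV P >-> borel V} := HB.pack S' (isMeasurableFun.Build _ _ _ _ _ mS').
have SE w : S w = (X ord0 w + S' w :> V)%R by rewrite /S big_ord_recl.
have mg d0 (T0 : measurableType d0) (u v : T0 -> borel V) :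
    measurable_fun setT u -> measurable_fun setT v ->
    measurable_fun setT (fun w => g ((u w : V) + v w)%R).
  move=> mu mv; apply: (measurableT_comp (measurable_continuous_borel (continuous_lipschitz1 glip))).
  exact: (measurable_borelD sepV).
have mgX u : measurable_fun setT (fun w => g ((X ord0 w : V) + u)%R).
  by apply: (mg _ T (X ord0) (fun=> u)).
have tonelli (phi : R -> R) : measurable_fun setT phi -> (forall y, 0 <= y -> 0 <= phi y)%R ->
    \int[P]_w (phi (g (S w)))%:E =
    \int[P]_w \int[P]_w' (phi (g ((X ord0 w' : V) + S' w)%R))%:E.
  move=> mphi phi0; under eq_integral do rewrite SE.
  apply: (@ge0_integral_independent _ _ T P _ _ (borel V) (borel V) S'RV (X ord0)
    (fun z => (phi (g ((z.2 : V) + z.1)%R))%:E)).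
  - by move=> A B mA mB; exact: (independent_head_tail sepV).
  - apply/measurable_EFinP; apply: (measurableT_comp mphi).
    exact: (mg _ (borel V * borel V)%type snd fst).
  - by move=> z; rewrite lee_fin phi0.
move=> intS.
have shift u v : \int[P]_w' (g ((X ord0 w' : V) + u)%R)%:E <=
    \int[P]_w' (g ((X ord0 w' : V) + v)%R)%:E + `|u - v|%:E.
  have -> : `|u - v|%:E = \int[P]_w' (cst `|u - v|%:E) w'.
    by rewrite integral_cst //= probability_setT mule1.
  rewrite -ge0_integralD //; last 3 first.
  - by move=> w _; rewrite lee_fin.
  - exact/measurable_EFinP.
  - by move=> w _; rewrite lee_fin normr_ge0.
  apply: ge0_le_integral => //.
  - by move=> w _; rewrite lee_fin.
  - exact/measurable_EFinP.
  - by apply: emeasurable_funD => //; exact/measurable_EFinP.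
  - move=> w _; rewrite /= -EFinD lee_fin -lerBlDl (le_trans (ler_norm _)) //.
    by apply: le_trans (glip _ _) _; rewrite opprD addrACA subrr add0r.
(* E g(S) is finite, so by Tonelli g(X_0 + u) has a finite mean for one value u
   of S', hence for all u because g is Lipschitz *)
have [w0 w0fin] : exists w0, \int[P]_w' (g ((X ord0 w' : V) + S' w0)%R)%:E < +oo.
  apply: contrapT => /forallNP H; move: intS; rewrite (tonelli id) //.
  rewrite (eq_integral (cst +oo)); last first.
    by move=> w _; apply/eqP; rewrite -leye_eq leNgt; apply/negP/H.
  by rewrite integral_cst //= probability_setT mule1 ltxx.
have gfin u : \int[P]_w' (g ((X ord0 w' : V) + u)%R)%:E \is a fin_num.
  rewrite ge0_fin_numE; last by apply: integral_ge0 => w _; rewrite lee_fin.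
  by apply: le_lt_trans (shift u (S' w0)) _; rewrite lte_add_pinfty // ltry.
pose g' u := fine (\int[P]_w' (g ((X ord0 w' : V) + u)%R)%:E).
have g'E u : \int[P]_w' (g ((X ord0 w' : V) + u)%R)%:E = (g' u)%:E by rewrite fineK.
have g'0 u : (0 <= g' u)%R.
  by apply/fine_ge0/integral_ge0 => w _; rewrite lee_fin.
have g'lip u v : (`|g' u - g' v| <= `|u - v|)%R.
  have sh a b : (g' a - g' b <= `|a - b|)%R.
    by rewrite lerBlDl -lee_fin EFinD -!g'E shift.
  by rewrite ler_norml lerNl opprB [X in (g' v - _ <= X)%R]distrC !sh.
have meanE : \int[P]_w (g (S w))%:E = \int[P]_w (g' (S' w))%:E.
  by rewrite (tonelli id) //; apply: eq_integral => w _; rewrite g'E.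
have intS' : \int[P]_w (g' (S' w))%:E < +oo by rewrite -meanE.
pose e0 := \int[P]_w (f `|(X ord0 w : V) - x ord0|%R)%:E.
have step u : \int[P]_w' (f (g ((X ord0 w' : V) + u)%R))%:E <= (f (g' u))%:E + K%:E * e0.
  apply: (@expectation_recentering f K (fun w' => g ((X ord0 w' : V) + u)%R)
    (fun w' => `|(X ord0 w' : V) - x ord0|%R) (g (x ord0 + u)%R)) => //.
  - apply/integrableP; split; first exact/measurable_EFinP.
    under eq_integral do rewrite gee0_abs ?lee_fin //.
    by rewrite /= g'E ltry.
  - apply: (measurableT_comp (@measurable_continuous_borel _ _
      (fun v => `|v - x ord0|%R) _)) => // v.
    by apply: cvg_norm; apply: cvgB; [exact: cvg_id|exact: cvg_cst].
  - by move=> w; apply: le_trans (glip _ _) _; rewrite opprD addrACA subrr addr0.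
have e00 : 0 <= e0 by apply: integral_ge0 => w _; rewrite lee_fin.
have mg' : measurable_fun setT (fun w => g' (S' w)).
  exact: (measurableT_comp (measurable_continuous_borel (continuous_lipschitz1 g'lip))).
have mfg' : measurable_fun setT (fun w => (f (g' (S' w)))%:E).
  by apply/measurable_EFinP; exact: measurableT_comp.
rewrite (tonelli f) //.
apply: (@le_trans _ _ (\int[P]_w ((f (g' (S' w)))%:E + K%:E * e0))).
  apply: ge0_le_integral => //.
  - by move=> w _; apply: integral_ge0 => w' _; rewrite lee_fin.
  - apply: (@measurable_fun_fubini_tonelli_F _ _ T T R P
      (fun z => (f (g ((X ord0 z.2 : V) + S' z.1)%R))%:E)).
      apply/measurable_EFinP/(measurableT_comp mf).
      apply: (mg _ (T * T)%type (fun z => X ord0 z.2) (fun z => S' z.1)).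
        exact: (measurableT_comp _ measurable_snd).
      exact: (measurableT_comp mS' measurable_fst).
    by move=> z; rewrite lee_fin.
  - by apply: emeasurable_funD => //.
rewrite ge0_integralD //; last 2 first.
- by move=> w _; rewrite lee_fin.
- by move=> w _; rewrite mule_ge0 // lee_fin ltW.
rewrite integral_cst //= probability_setT mule1.
rewrite big_ord_recl -/e0; set e' := (X in e0 + X).
have e'0 : 0 <= e'.
  by apply: sume_ge0 => i _; apply: integral_ge0 => w _; rewrite lee_fin.
rewrite (@ge0_muleDr _ K%:E e0 e') // addeCA addeC; apply: leeD2r; rewrite meanE.
by have := IH (fun i => X (lift ord0 i)) (fun i => x (lift ord0 i)) g'
  (mutually_independent_lift indX) g'0 g'lip intS'.
Qed.

End Recentering.

Theorem corollary1p12 (R : realType) (d : measure_display)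
    (T : measurableType d) (P : probability T R)
    (V : completeNormedModType R) (sepV : separable_space V)
    (n : nat) (X : 'I_n -> {RV P >-> borel V})
    (indepX : mutually_independent P (fun i => X i : T -> borel V))
    (S := fun w : T => (\sum_(i < n) (X i w : V))%R)
    (intS : 'E_P[fun w => `|S w|%R] < +oo)
    (x : 'I_n -> V) :
  (forall f : R -> R, F12 f -> f <> cst 0%R ->
    'E_P[fun w => f `|S w|%R] <=
      (f (fine 'E_P[fun w => `|S w|%R]))%:E +
      kappa f * C_ f *
        \sum_(i < n) 'E_P[fun w => f `|(X i w : V) - x i|%R]) /\
  (forall p : R, (1 < p <= 2)%R ->
    'E_P[fun w => (`|S w| `^ p)%R] <=
      (fine 'E_P[fun w => `|S w|%R] `^ p)%:E +
      kappatilde p * Ctilde p *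
        \sum_(i < n) 'E_P[fun w => (`|(X i w : V) - x i| `^ p)%R]).
Proof.
have bound (f : R -> R) : F12 f -> f <> cst 0%R ->
    'E_P[fun w => f `|S w|%R] <=
      (f (fine 'E_P[fun w => `|S w|%R]))%:E +
      kappa f * C_ f *
        \sum_(i < n) 'E_P[fun w => f `|(X i w : V) - x i|%R].
  move=> Ff fN0; have [K [-> K0 frec]] := F12_recentering Ff fN0.
  move: intS; rewrite unlock => intS.
  apply: (@expectation_sum_recentering _ _ _ P _ sepV f K (F12_continuous Ff)
    (F12_ge0 Ff) K0 frec (F12_le_norm Ff) n X x (fun v => `|v|%R)) => //.
  by move=> u v; exact: ler_dist_dist.
split=> // p p12.
have abspE (v : V) : absp p `|v|%R = (`|v| `^ p)%R by rewrite /absp normr_id.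
have := bound _ (F12_absp p12) (@absp_neq0 R p).
under eq_fun do rewrite abspE.
under eq_bigr => i _ do under eq_fun do rewrite abspE.
rewrite {1}/absp ger0_norm // fine_ge0 // unlock.
by apply: integral_ge0 => w _; rewrite lee_fin.
Qed.
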